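(* Define $V(x)=\int_0^x\frac{1}{\sigma(y)}\,dy$ and $\gamma=2\int_{\mathbb{R}}\frac{m^2}{\sigma^2}\,d\Pi$. If the following three conditions are satisfied: (a) $\int_{\mathbb{R}}V^2\,d\Pi<\infty$, (b) $\int_{\mathbb{R}}\sigma^2\,d\Pi<\infty$, (c) $\gamma<\infty$, then the spectral gap $\mathfrak{G}$ of the generator $\mathcal{G}$ satisfies $\mathfrak{G}\le\gamma$.
   Context: Let $\sigma:\mathbb{R}\to(0,\infty)$ and $m:\mathbb{R}\to\mathbb{R}$ be smooth functions such that $\int_{-\infty}^{0}\frac{1}{\sigma(x)}\exp\left(-\int_0^x\frac{2m}{\sigma^2}\right)dx=\int_{0}^{\infty}\frac{1}{\sigma(x)}\exp\left(-\int_0^x\frac{2m}{\sigma^2}\right)dx=\infty$ and $\Lambda:=\int_{\mathbb{R}}\frac{1}{\sigma(x)}\exp\left(\int_0^x\frac{2m}{\sigma^2}\right)dx<\infty$. Let $X_t$ be the positive recurrent diffusion solving the Stratonovich SDE $X_t=x+\int_0^t\sigma(X_r)\circ db(r)+\int_0^t m(X_r)\,dr$. Put $\psi^2(x)=\Lambda\,\sigma(x)\exp\left(-\int_0^x\frac{2m}{\sigma^2}\right)$. The invariant probability measure of $X$ is $d\Pi(x)=\psi^{-2}(x)\,dx$, the scale function $s$ has derivative $s'=\psi^2/\sigma^2$, and the generator of $X$ is $\mathcal{G}=\frac{\sigma^2}{2}\frac{d^2}{dx^2}+\left(m+\frac12\sigma\sigma'\right)\frac{d}{dx}=\frac12\psi^2\frac{d}{dx}\left(\frac{\sigma^2}{\psi^2}\frac{d}{dx}\right)$,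 which is symmetric in $L^2(\mathbb{R},d\Pi)$. The spectral gap $\mathfrak{G}$ of $\mathcal{G}$ (the modulus of the first nontrivial eigenvalue) is characterized by $$\mathfrak{G}=\inf_{f\in Q}\left\{\frac12\int_{\mathbb{R}}\frac{(f')^2}{s'}\,dx\right\},\qquad Q=\left\{f\in L^2(\mathbb{R},d\Pi)\text{ smooth}:\ \int_{\mathbb{R}}f\,d\Pi=0,\ \int_{\mathbb{R}}f^2\,d\Pi=1\right\}.$$ *)

(* Defs.v *)
From mathcomp Require Import all_boot all_order all_algebra.
From mathcomp Require Import all_classical all_reals all_analysis.
From mathcomp Require Import measurable_realfun ring lra.
Import Order.TTheory GRing.Theory Num.Theory.
Import numFieldNormedType.Exports.

Set Implicit Arguments.
Unset Strict Implicit.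
Unset Printing Implicit Defensive.

Local Open Scope ring_scope.
Local Open Scope classical_set_scope.

Section Diffusion.
Context {R : realType}.
Local Notation mu := (@lebesgue_measure R).

Definition smooth (f : R -> R) : Prop :=
  forall (n : nat) (x : R), derivable (derive1n n f) x 1.

(* The oriented integral of h from 0 to x, with a minus sign when x < 0 *)
Definition int0 (h : R -> R) (x : R) : R :=
  if 0 <= x then \int[mu]_(t in `[0, x]) h t
  else - \int[mu]_(t in `[x, 0]) h t.

Variables sigma m : R -> R.

Definition drift_int : R -> R := int0 (fun y => 2 * m y / sigma y ^+ 2).

(* Lambda as an extended real; its finiteness is a hypothesis of the theorem *)
Definition total_mass : \bar R :=
  (\int[mu]_x ((sigma x)^-1 * expR (drift_int x))%:E)%E.

Definition Lambda : R := fine total_mass.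

Definition psi2 (x : R) : R := Lambda * sigma x * expR (- drift_int x).

(* A plain set function, to which the library integral applies: that it is a
   measure needs measurability of psi2, hence regularity of sigma and m *)
Definition Pi (A : set (measurableTypeR R)) : \bar R :=
  (\int[mu]_(x in A) ((psi2 x)^-1)%:E)%E.

Definition scale_deriv (x : R) : R := psi2 x / sigma x ^+ 2.

(* The generator of the Stratonovich equation dX = sigma(X) o db + m(X) dt:
   the Ito correction adds sigma sigma' / 2 to the drift *)
Definition generator (f : R -> R) (x : R) : R :=
  sigma x ^+ 2 / 2 * derive1n 2 f x + (m x + sigma x * derive1 sigma x / 2) * derive1 f x.

(* The Dirichlet form of the generator G in L^2(Pi): by generator_divE below,
   it is - <G f, f> after an integration by parts *)
Definition energy (f : R -> R) : \bar R :=
  ((2^-1)%:E * \int[mu]_x (derive1 f x ^+ 2 / scale_deriv x)%:E)%E.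

Definition in_Q (f : R -> R) : Prop :=
  [/\ smooth f,
      Pi.-integrable setT (fun x => (f x ^+ 2)%:E),
      (\int[Pi]_x (f x)%:E = 0)%E &
      (\int[Pi]_x (f x ^+ 2)%:E = 1)%E].

(* The variational form of the gap between 0 and the rest of the spectrum of
   the symmetric operator - generator in L^2(Pi) *)
Definition spectral_gap : \bar R := ereal_inf [set energy f | f in in_Q].

Definition V : R -> R := int0 (fun y => (sigma y)^-1).

Definition gamma : \bar R :=
  (2%:E * \int[Pi]_x (m x ^+ 2 / sigma x ^+ 2)%:E)%E.

End Diffusion.

Section DiffusionTheory.
Context {R : realType}.
Local Notation mu := (@lebesgue_measure R).
Lemma continuous_itv_integrable (h : R -> R) a b : continuous h ->
  mu.-integrable `[a, b] (EFin \o h).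
Proof.
move=> hc; apply: continuous_compact_integrable; first exact: segment_compact.
exact: continuous_subspaceT.
Qed.

Lemma int_itv_diff (h : R -> R) a b c : continuous h -> a <= b -> b <= c ->
  \int[mu]_(t in `[b, c]) h t =
  \int[mu]_(t in `[a, c]) h t - \int[mu]_(t in `[a, b]) h t.
Proof.
move=> hc ab bc.
rewrite Rintegral_itvB ?bnd_simp//; last exact: continuous_itv_integrable.
rewrite Rintegral_itv_obnd_cbnd//.
have := @continuous_itv_integrable h b c hc.
apply: integrableS => //; apply: subset_itvr; by rewrite bnd_simp.
Qed.

Lemma is_derive_int0 (h : R -> R) (x : R) : continuous h ->
  is_derive x 1 (int0 h) (h x).
Proof.
move=> hc.
pose a := - (`|x| + 1); pose b := `|x| + 1.
pose G y := \int[mu]_(t in `[a, y]) h t.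
have ax : a < x by rewrite /a; have := ler_norm (- x); rewrite normrN; lra.
have xb : x < b by rewrite /b; have := ler_norm x; lra.
have a0 : a <= 0 by rewrite /a; have := normr_ge0 x; lra.
have GE : forall y, a <= y -> G y - G 0 = int0 h y.
  move=> y ay; rewrite /int0; case: ifPn => y0.
    by rewrite (int_itv_diff hc a0 y0).
  have {}y0 : y <= 0 by rewrite -ltNge in y0; exact: ltW.
  by rewrite (int_itv_diff hc ay y0) opprB.
have [dG G'] := @continuous_FTC1_closed R h a x b xb
  (@continuous_itv_integrable h a b hc) ax (hc x).
apply: (@near_eq_is_derive _ _ _ (fun y => G y - G 0)).
  by near=> y; apply: GE; near: y; exact: lt_le_nbhsr.
have -> : h x = h x - 0 by rewrite subr0.
apply: is_deriveB.
by rewrite -G'; rewrite derive1E; exact/derivableP.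
Unshelve. all: by end_near. Qed.

Variables sigma m : R -> R.
Hypotheses (ss : smooth sigma) (sm : smooth m) (s0 : forall x, 0 < sigma x).

Lemma smooth_continuous f : @smooth R f -> continuous f.
Proof.
move=> sf x; apply: differentiable_continuous; apply/derivable1_diffP.
exact: (sf 0%N).
Qed.

Let cont_drift : continuous (fun y => 2 * m y / sigma y ^+ 2).
Proof.
have cs := smooth_continuous ss; have cm := smooth_continuous sm.
move=> x; apply: cvgM; first by apply: cvgM; [exact: cvg_cst|exact: cm].
by apply: cvgV; [rewrite expf_eq0/= gt_eqF|rewrite expr2; apply: cvgM; exact: cs].
Qed.

Lemma is_derive_drift_int (x : R) :
  is_derive x 1 (drift_int sigma m : R -> R) (2 * m x / sigma x ^+ 2).
Proof. exact: is_derive_int0 cont_drift. Qed.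

Lemma continuous_drift_int : continuous (drift_int sigma m).
Proof.
move=> x; apply: differentiable_continuous; apply/derivable1_diffP.
by have [] := is_derive_drift_int x.
Qed.

Let w (x : R) : R := (sigma x)^-1 * expR (drift_int sigma m x).
Let cw : continuous w.
Proof.
move=> x; apply: cvgM.
  by apply: cvgV; [rewrite gt_eqF|exact: (smooth_continuous ss)].
by apply: continuous_comp; [exact: continuous_drift_int|exact: continuous_expR].
Qed.
Let w0 x : 0 < w x. Proof. by rewrite mulr_gt0 ?invr_gt0 ?expR_gt0. Qed.

Lemma total_mass_gt0 : (0 < total_mass sigma m)%E.
Proof.
have mw : @measurable_fun _ _ (measurableTypeR R) (\bar R) setT (EFin \o w).
  by apply/measurable_EFinP; exact: continuous_measurable_fun.
rewrite lt_neqAle integral_ge0 ?andbT; last by move=> x _; rewrite lee_fin ltW// w0.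
apply/eqP => /esym tm0.
have : (\int[mu]_x `|(w x)%:E| = 0)%E.
  by rewrite -tm0; apply: eq_integral => x _; rewrite abse_EFin ger0_norm// ltW// w0.
move/(ae_eq_integral_abs mu measurableT mw) => [N [mN N0 wN]].
suff /eqP : (mu [set: R] = 0)%E by rewrite -set_itvNyy lebesgue_measure_itv.
apply/eqP; rewrite -measure_le0 -N0 le_measure ?inE// => x _; apply: wN => /=.
by move=> /(_ I) [] /eqP; rewrite gt_eqF// w0.
Qed.

Hypothesis tm_fin : (total_mass sigma m < +oo)%E.

Lemma Lambda_gt0 : 0 < Lambda sigma m.
Proof. by rewrite fine_gt0// total_mass_gt0. Qed.

Lemma Pi_setT : Pi sigma m setT = 1%E.
Proof.
have L0 := Lambda_gt0.
have mw : @measurable_fun _ _ (measurableTypeR R) (\bar R) setT (EFin \o w).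
  by apply/measurable_EFinP; exact: continuous_measurable_fun.
rewrite /Pi (_ : (\int[_]_(x in _) _)%E =
    (\int[mu]_x ((Lambda sigma m)^-1%:E * (w x)%:E))%E); last first.
  apply: eq_integral => x _; rewrite -EFinM /psi2 /w expRN !invfM invrK.
  by rewrite mulrA.
rewrite ge0_integralZl_EFin//; last 2 first.
- by move=> x _; rewrite lee_fin ltW// w0.
- by rewrite invr_ge0 ltW.
rewrite -/(total_mass sigma m) -(@fineK _ (total_mass sigma m)); last first.
  by rewrite ge0_fin_numE// ltW// total_mass_gt0.
by rewrite -EFinM mulVf// gt_eqF.
Qed.

Lemma generator_divE (f : R -> R) (x : R) : smooth f ->
  generator sigma m f x =
  psi2 sigma m x / 2 * derive1 (fun y => derive1 f y / scale_deriv sigma m y) x.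
Proof.
move=> sf; have L0 := Lambda_gt0.
have sx y : sigma y != 0 by rewrite gt_eqF.
have -> : (fun y => derive1 f y / scale_deriv sigma m y) =
  (Lambda sigma m)^-1 \*o (derive1 f * (sigma * (expR \o drift_int sigma m))).
  apply/funext => y /=; rewrite /scale_deriv /psi2 expRN /= !fctE.
  by field; rewrite !gt_eqF// expR_gt0.
have dD := is_derive_drift_int x.
have dE : is_derive x 1 (expR \o drift_int sigma m : R -> R)
  (2 * m x / sigma x ^+ 2 * expR (drift_int sigma m x)).
  have := @is_derive1_comp R expR (drift_int sigma m) x _ _ (is_derive_expR _) dD.
  by rewrite mulrC.
have df : is_derive x 1 (derive1 f : R -> R) (derive1n 2 f x).
  by rewrite /= derive1E; apply/derivableP; exact: (sf 1%N).
have ds : is_derive x 1 (sigma : R -> R) (derive1 sigma x).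
  by rewrite derive1E; apply/derivableP; exact: (@ss 0%N x).
rewrite derive1E.
rewrite derive_val /generator /psi2 /= !fctE expRN /GRing.scale/=.
by field; rewrite !gt_eqF// expR_gt0.
Qed.
End DiffusionTheory.

(* Main.v *)
Require Import Defs.
From HB Require Import structures.
From mathcomp Require Import all_boot all_order all_algebra.
From mathcomp Require Import all_classical all_reals all_analysis.
From mathcomp Require Import measurable_realfun ring lra.

(** The gap is bounded by the energy of one test function, the centered and
    normalized [V]. Write [p = psi^{-2}] for the density of [Pi], [c] for the
    mean of [V] and [B] for its variance under [Pi]. Since [V' = 1 / sigma],
    the energy integrand [(V')^2 / s'] is [p] itself, so the energy of [V] is
    [1/2] and the gap is at most [1 / (2 B)] ([spectral_gap_le_variance]).

    It remains to see that [gamma B >= 1/2], where [gamma = 2 A] and [A] is the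
    integral of [(m / sigma)^2] against [Pi]. By Cauchy-Schwarz, [A B] is at
    least the square of the integral of [(m / sigma) (V - c) p], and this
    integral is exactly [- 1/2] ([integral_drift_V]): the density satisfies
    [(sigma p)' = 2 (m / sigma) p], so the product [G = sigma p (V - c)] has
    derivative [2 (m / sigma) (V - c) p + p], and the integral of [G'] over the
    line vanishes, while that of [p] is [1].

    The vanishing of the boundary terms of this integration by parts is where
    recurrence enters. Up to the constant [Lambda], the divergent integrand
    [q = exp (- drift) / sigma] satisfies [q G^2 = p (V - c)^2], which is
    integrable since [V] is square integrable. If [|G|] were bounded below by
    some [e > 0] near one end of the line, then [q] would be integrable there,
    contradicting recurrence ([small_far_out]). Hence [G] comes arbitrarily
    close to [0] arbitrarily far out on both sides, and, [G'] being integrable,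
    integrating it over intervals between such points gives [0] in the limit
    ([integral_derivative_eq0]). *)

Set Implicit Arguments.
Unset Strict Implicit.
Unset Printing Implicit Defensive.
Import Order.TTheory GRing.Theory Num.Theory.
Import numFieldNormedType.Exports.
Local Open Scope classical_set_scope.
Local Open Scope ring_scope.

(** * Stability of smoothness *)

Section SmoothClosure.
Context {R : realType}.
Implicit Types (f g : R -> R) (n : nat).

(** Smoothness says that every derivative has a derivative; cutting it off at
    order [n] is what makes the product and inverse rules provable by induction,
    as each of them expresses a derivative through the function itself. *)
Definition nderivable n f : Prop :=
  forall k x, (k < n)%N -> derivable (derive1n k f) x 1.

Lemma nderivableS n f :
  nderivable n.+1 f <-> (forall x, derivable f x 1) /\ nderivable n (derive1 f).
Proof.
split=> [df|[df df'] [|k] x kn]; first split=> [x|k x kn].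
- exact: (df 0%N x).
- by rewrite -derive1Sn; exact: df.
- exact: df.
- by rewrite derive1Sn; exact: df'.
Qed.

Lemma nderivable0 f : nderivable 0 f.
Proof. by move=> k x; rewrite ltn0. Qed.

Lemma smooth_nderivable f : smooth f <-> forall n, nderivable n f.
Proof. by split=> [df n k x _|df n x]; [exact: df|exact: (df n.+1)]. Qed.

Lemma nderivableW n f : nderivable n.+1 f -> nderivable n f.
Proof. by move=> df k x kn; apply: df; exact: ltnW. Qed.

Lemma nderivable_cst n (c : R) : nderivable n (cst c).
Proof.
elim: n c => [|n IHn] c; first exact: nderivable0.
apply/nderivableS; split=> [x|].
  exact: derivable_cst.
rewrite (_ : derive1 (cst c) = cst 0)//.
by apply/funext => x; rewrite derive1_cst.
Qed.

Lemma nderivableD n f g :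
  nderivable n f -> nderivable n g -> nderivable n (fun x => f x + g x).
Proof.
elim: n f g => [|n IHn] f g; first by move=> *; exact: nderivable0.
move=> /nderivableS[df df'] /nderivableS[dg dg'].
apply/nderivableS; split=> [x|]; first exact: derivableD.
rewrite (_ : derive1 _ = fun x => derive1 f x + derive1 g x); first exact: IHn.
by apply/funext => x; rewrite !derive1E deriveD.
Qed.

Lemma nderivableM n f g :
  nderivable n f -> nderivable n g -> nderivable n (fun x => f x * g x).
Proof.
elim: n f g => [|n IHn] f g; first by move=> *; exact: nderivable0.
move=> df1 dg1.
have [df df'] := (nderivableS _ _).1 df1.
have [dg dg'] := (nderivableS _ _).1 dg1.
apply/nderivableS; split=> [x|]; first exact: derivableM.
rewrite (_ : derive1 _ = fun x => f x * derive1 g x + g x * derive1 f x).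
  apply: nderivableD; [apply: IHn dg'|apply: IHn df']; exact: nderivableW.
by apply/funext => x; rewrite !derive1E deriveM.
Qed.

Lemma nderivableV n f : (forall x, f x != 0) ->
  nderivable n f -> nderivable n (fun x => (f x)^-1).
Proof.
move=> f0; elim: n => [|n IHn] df1; first exact: nderivable0.
have [df df'] := (nderivableS _ _).1 df1.
have IHf : nderivable n (fun x => (f x)^-1).
  by apply: IHn; exact: nderivableW.
apply/nderivableS; split=> [x|]; first exact: derivableV.
rewrite (_ : derive1 _ = fun x => (-1) * ((f x)^-1 * ((f x)^-1 * derive1 f x))).
  apply: nderivableM; first exact: nderivable_cst.
  by apply: (nderivableM IHf); exact: nderivableM IHf df'.
apply/funext => x; rewrite derive1E deriveV// derive1E.
by rewrite expr2 invfM scaleNr /GRing.scale/= mulN1r !mulrA.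
Qed.

Lemma smooth_derive1 f :
  (forall x, derivable f x 1) -> smooth (derive1 f) -> smooth f.
Proof.
move=> df /smooth_nderivable df'; apply/smooth_nderivable => n.
by apply: nderivableW; apply/nderivableS; split.
Qed.

End SmoothClosure.

(** * Integration against a density *)

Section Density.
Context d (T : measurableType d) (R : realType).
Variables (mu : {sigma_finite_measure set T -> \bar R}) (g : T -> R).
Hypotheses (g0 : forall x, 0 <= g x) (ig : mu.-integrable setT (EFin \o g)).
Local Open Scope ereal_scope.

Definition density (A : set T) := \int[mu]_(x in A) (g x)%:E.

Let density0 : density set0 = 0. Proof. exact: integral_set0. Qed.

Let density_ge0 A : 0 <= density A.
Proof. by apply: integral_ge0 => x _; rewrite lee_fin. Qed.

Let density_sigma_additive : semi_sigma_additive density.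
Proof.
move=> A mA tA mUA; rewrite /density integral_bigcup//; last first.
  exact: integrableS ig.
by apply: is_cvg_ereal_nneg_natsum_cond => n _ _; exact: density_ge0.
Qed.

HB.instance Definition _ := isMeasure.Build d T R density
  density0 density_ge0 density_sigma_additive.

Let density_fin : fin_num_fun density.
Proof.
by move=> A mA; apply: integrable_fin_num => //; exact: integrableS ig.
Qed.

HB.instance Definition _ := Measure_isFinite.Build d T R density density_fin.

Let nu : {finite_measure set T -> \bar R} := density.

Let numu : nu `<< mu.
Proof.
apply/null_content_dominatesP => A mA muA0.
apply: null_set_integral => //.
by apply: (measurable_int mu); exact: integrableS ig.
Qed.

(** The density [g] is a Radon-Nikodym derivative of [density] with respect to
    [mu], so it agrees almost everywhere with the abstract one, for which the
    change of variables is known. *)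
Lemma ge0_integral_density (f : T -> \bar R) : (forall x, 0 <= f x) ->
  measurable_fun setT f ->
  \int[density]_x f x = \int[mu]_x (f x * (g x)%:E).
Proof.
move=> f0 mf.
rewrite -[LHS]/(\int[nu]_x f x).
rewrite -(Radon_Nikodym_SigmaFinite.change_of_variables numu f0)//.
have ih := Radon_Nikodym_SigmaFinite.f_integrable numu.
apply: ae_eq_integral => //.
- by apply: emeasurable_funM => //; exact: measurable_int ih.
- by apply: emeasurable_funM => //; exact: measurable_int ig.
- apply: ae_eqe_mul2l; apply: integral_ae_eq => //.
    exact: measurable_int ig.
  by move=> E _ mE; rewrite -Radon_Nikodym_SigmaFinite.f_integral.
Qed.

Lemma integral_density (f : T -> \bar R) : measurable_fun setT f ->
  \int[density]_x f x = \int[mu]_x (f x * (g x)%:E).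
Proof.
move=> mf; rewrite integralE [RHS]integralE.
congr (_ - _); rewrite ge0_integral_density//.
- apply: eq_integral => x _; rewrite !funeposE.
  by rewrite maxe_pMl ?mul0e// lee_fin.
- exact: measurable_funepos.
- apply: eq_integral => x _; rewrite !funenegE.
  by rewrite -mulNe maxe_pMl ?mul0e// lee_fin.
- exact: measurable_funeneg.
Qed.

Lemma integrable_density (f : T -> \bar R) : measurable_fun setT f ->
  density.-integrable setT f <->
  mu.-integrable setT (fun x => f x * (g x)%:E).
Proof.
move=> mf; have mfg : measurable_fun setT (fun x => f x * (g x)%:E).
  by apply: emeasurable_funM => //; exact: measurable_int ig.
have E : \int[density]_x `|f x| = \int[mu]_x `|f x * (g x)%:E|.
  rewrite integral_density; last exact: measurableT_comp.
  by apply: eq_integral => x _; rewrite abseM (@gee0_abs _ (g x)%:E)// lee_fin.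
by split=> /integrableP[_ h]; apply/integrableP; split; rewrite // ?E// -E.
Qed.
End Density.

(** * The Cauchy-Schwarz inequality with a weight *)

Section WeightedCauchySchwarz.
Context d (T : measurableType d) (R : realType).
Variables (mu : {measure set T -> \bar R}) (a b w : T -> R).
Hypotheses (ma : measurable_fun setT a) (mb : measurable_fun setT b).
Hypotheses (mw : measurable_fun setT w) (w0 : forall x, 0 <= w x).
Hypothesis ia : mu.-integrable setT (fun x => (a x ^+ 2 * w x)%:E).
Hypothesis ib : mu.-integrable setT (fun x => (b x ^+ 2 * w x)%:E).

Lemma integrable_weighted_prod :
  mu.-integrable setT (fun x => (a x * b x * w x)%:E).
Proof.
apply: le_integrable (integrableD measurableT ia ib) => //.
  apply/measurable_EFinP; apply: measurable_funM => //.
  exact: measurable_funM.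
move=> x _ /=; rewrite lee_fin.
have sq0 r : 0 <= r ^+ 2 * w x by rewrite mulr_ge0 ?sqr_ge0.
rewrite [leRHS]ger0_norm ?addr_ge0//.
rewrite normrM (ger0_norm (w0 x)) -mulrDl ler_wpM2r// normrM.
rewrite -(real_normK (num_real (a x))) -(real_normK (num_real (b x))).
have := normr_ge0 (a x); have := normr_ge0 (b x).
by have := sqr_ge0 (`|a x| - `|b x|); nra.
Qed.

(** The integral of [(a + t b)^2 w] is a nonnegative quadratic polynomial in
    [t], so its discriminant is nonpositive. *)
Lemma weighted_cauchy_schwarz :
  (\int[mu]_x (a x * b x * w x)) ^+ 2 <=
  (\int[mu]_x (a x ^+ 2 * w x)) * (\int[mu]_x (b x ^+ 2 * w x)).
Proof.
have iab := integrable_weighted_prod.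
set H := \int[mu]_x (a x * b x * w x).
set A := \int[mu]_x (a x ^+ 2 * w x).
set B := \int[mu]_x (b x ^+ 2 * w x).
have AtB t : 0 <= A + t * (2 * H) + t ^+ 2 * B.
  have <- : \int[mu]_x ((a x + t * b x) ^+ 2 * w x) =
      A + t * (2 * H) + t ^+ 2 * B.
    have it1 : mu.-integrable setT
        (EFin \o (fun x => 2 * t * (a x * b x * w x))).
      exact: (integrableZl measurableT (2 * t) iab).
    have it2 : mu.-integrable setT
        (EFin \o (fun x => t ^+ 2 * (b x ^+ 2 * w x))).
      exact: (integrableZl measurableT (t ^+ 2) ib).
    rewrite /A /B /H mulrA (mulrC t 2) -RintegralZl// -RintegralZl//.
    rewrite -RintegralD// -RintegralD//; last first.
      exact: (integrableD measurableT ia it1).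
    by apply: eq_Rintegral => x _; ring.
  by apply: Rintegral_ge0 => x _; rewrite mulr_ge0 ?sqr_ge0.
pose P : {poly R} := Poly [:: A; 2 * H; B].
have := @deg_le2_poly_ge0 R P (size_Poly _).
rewrite !coef_Poly/= => /(_ _)/wrap[x|].
  rewrite horner_Poly /=.
  by rewrite (_ : _ + A = A + x * (2 * H) + x ^+ 2 * B) //; ring.
by nra.
Qed.
End WeightedCauchySchwarz.

(** * Integrals over the whole line *)

Section WholeLine.
Context {R : realType}.
Local Notation mu := (@lebesgue_measure R).

Lemma measurable_continuous (h : R -> R) : continuous h ->
  measurable_fun (setT : set (measurableTypeR R)) h.
Proof. exact: continuous_measurable_fun. Qed.

(** If [|G| >= e] held on all of [A] where [N < |x|], then [q] would be
    dominated there by [e^-2 k] and elsewhere by its restriction to the compact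
    interval from [- N] to [N], so it would be integrable on [A]. Taking a
    half-line for [A] gives points far out towards one end where [G] is small. *)
Lemma small_far_out (q G k : R -> R) (A : set (measurableTypeR R)) (e N : R) :
  measurable A -> continuous q -> (forall x, 0 <= q x) ->
  mu.-integrable setT (EFin \o k) ->
  (forall x, q x * G x ^+ 2 <= k x) ->
  (\int[mu]_(x in A) (q x)%:E = +oo)%E -> 0 < e ->
  exists x, [/\ A x, N < `|x| & `|G x| < e].
Proof.
move=> mA cq q0 ik qk qoo e0; apply: contrapT => /forallNP far.
suff : mu.-integrable A (EFin \o q).
  move=> /integrableP[_]; under eq_integral do rewrite /= ger0_norm//.
  by rewrite qoo ltxx.
have iqN : mu.-integrable setT
    ((EFin \o q) \_ (`[- N, N] : set (measurableTypeR R))).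
  apply/integrable_restrict => //; rewrite setTI.
  exact: continuous_itv_integrable.
have ike : mu.-integrable setT (fun x => ((e ^- 2)%:E * (k x)%:E)%E).
  exact: integrableZl.
have iqk := integrableS measurableT mA (@subsetT _ _)
   (integrableD measurableT iqN ike).
apply: le_integrable iqk => //.
  apply/measurable_EFinP; apply: measurable_funTS; exact: measurable_continuous.
move=> x Ax /=; rewrite ger0_norm//.
have ke0 : 0 <= e ^- 2 * k x.
  apply: mulr_ge0; first by rewrite invr_ge0 sqr_ge0.
  by apply: le_trans (qk x); rewrite mulr_ge0 ?sqr_ge0.
rewrite patchE; case: ifPn => [_|].
  by rewrite -!EFinM -EFinD lee_fin ger0_norm ?addr_ge0// lerDl.
rewrite notin_setE/= in_itv/= -ler_norml => /negP; rewrite -ltNge => xN.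
have Ge : e <= `|G x| by rewrite leNgt; apply/negP => Gx; exact: (far x).
rewrite add0r lee_fin ger0_norm//.
rewrite -ler_pdivrMl ?invr_gt0 ?exprn_gt0// invrK mulrC; apply: le_trans (qk x).
by rewrite ler_wpM2l// -(real_normK (num_real (G x))) lerXn2r// nnegrE ltW.
Qed.

Lemma continuous_FTC (G g : R -> R) (a b : R) : a < b -> continuous g ->
  (forall x : R, is_derive x 1 G (g x)) ->
  (\int[mu]_(x in `[a, b]) (g x)%:E = (G b - G a)%:E)%E.
Proof.
move=> ab cg dG.
have cG : continuous G.
  move=> x; apply: differentiable_continuous; apply/derivable1_diffP.
  by have [] := dG x.
rewrite EFinB; apply: continuous_FTC2 => //.
- exact: continuous_subspaceT.
- split.
  + by move=> x _; have [] := dG x.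
  + exact/cvg_at_right_filter/cG.
  + exact/cvg_at_left_filter/cG.
- by move=> x _; rewrite derive1E; have [_ ->] := dG x.
Qed.

(** As [g] is integrable, its integral is the limit of the integrals over any
    intervals exhausting the line. Their ends are taken along two sequences on
    which [G] tends to [0]; this avoids a limit of [G] at infinity, which the
    recurrence argument does not give directly. *)
Lemma integral_derivative_eq0 (G g : R -> R) : continuous g ->
  (forall x : R, is_derive x 1 G (g x)) ->
  mu.-integrable setT (EFin \o g) ->
  (forall e N : R, 0 < e -> exists x, N < x /\ `|G x| < e) ->
  (forall e N : R, 0 < e -> exists x, N < - x /\ `|G x| < e) ->
  (\int[mu]_x (g x)%:E = 0)%E.
Proof.
move=> cg dG ig Gr Gl.
have /choice[b bP] n : exists x, n%:R < x /\ `|G x| < n.+1%:R^-1.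
  by apply: Gr; rewrite invr_gt0.
have /choice[a aP] n : exists x, n%:R < - x /\ `|G x| < n.+1%:R^-1.
  by apply: Gl; rewrite invr_gt0.
pose I n : set (measurableTypeR R) := `[a n, b n]%classic.
have mI n : measurable (I n) by exact: measurable_itv.
have IE n : (\int[mu]_x ((EFin \o g) \_ (I n)) x = (G (b n) - G (a n))%:E)%E.
  rewrite -integral_mkcond; apply: continuous_FTC => //.
  have [nb _] := bP n; have [na _] := aP n.
  by have := ler0n R n; lra.
have mg := measurable_int _ ig.
have I_lim : (\int[mu]_x ((EFin \o g) \_ (I n)) x)%E @[n --> \oo] -->
    (\int[mu]_x (g x)%:E)%E.
  apply: (@dominated_cvg _ _ _ mu setT measurableT _ (EFin \o g)
    (abse \o (EFin \o g))) => //.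
  - move=> n; apply/(measurable_restrictT _ (mI n)); exact: measurable_funTS mg.
  - move=> x _; apply: (@cvg_near_cst _ _ _ _ _); near=> n.
    rewrite patchE ifT// inE /I/= in_itv/=.
    have [nb _] := bP n; have [na _] := aP n.
    have : `|x| <= n%:R by near: n; exact: nbhs_infty_ger.
    by rewrite ler_norml => /andP[]; lra.
  - exact: integrable_abse.
  - move=> n x _ /=; rewrite patchE; case: ifP => // _.
    by rewrite abse0.
have I_lim0 : (\int[mu]_x ((EFin \o g) \_ (I n)) x)%E @[n --> \oo] --> 0%:E.
  under eq_fun do rewrite IE.
  apply: cvg_EFin; first by near=> n.
  rewrite -(subr0 (0 : R)); apply: cvgB.
    apply: norm_cvg0; apply: (squeeze_cvgr _ (cvg_cst 0) (@cvg_harmonic R)).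
    by near=> n; rewrite normr_ge0 ltW//; have [] := bP n.
  apply: norm_cvg0; apply: (squeeze_cvgr _ (cvg_cst 0) (@cvg_harmonic R)).
  by near=> n; rewrite normr_ge0 ltW//; have [] := aP n.
exact: (cvg_unique _ I_lim I_lim0).
Unshelve. all: by end_near. Qed.
End WholeLine.

(** * The invariant density *)

Section Diffusion.
Context {R : realType}.
Local Notation mu := (@lebesgue_measure R).
Variables sigma m : R -> R.
Hypotheses (ss : smooth sigma) (sm : smooth m) (s0 : forall x, 0 < sigma x).
Hypothesis tm_fin : (total_mass sigma m < +oo)%E.

Local Notation D := (drift_int sigma m).
Local Notation L := (Lambda sigma m).
Definition invariant_density (x : R) : R := (psi2 sigma m x)^-1.
Local Notation p := invariant_density.

Let L0 : 0 < L. Proof. exact: Lambda_gt0. Qed.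
Let cs : continuous sigma. Proof. exact: smooth_continuous. Qed.
Let cm : continuous m. Proof. exact: smooth_continuous. Qed.
Let cD : continuous D. Proof. exact: continuous_drift_int. Qed.

Let csV : continuous (fun x => (sigma x)^-1).
Proof. by move=> x; apply: cvgV; [rewrite gt_eqF|exact: cs]. Qed.

Lemma is_derive_V (x : R) : is_derive x 1 (V sigma : R -> R) (sigma x)^-1.
Proof. exact: (is_derive_int0 x csV). Qed.

Lemma continuous_V : continuous (V sigma).
Proof.
move=> x; apply: differentiable_continuous; apply/derivable1_diffP.
by have [] := is_derive_V x.
Qed.

Lemma invariant_density_gt0 x : 0 < p x.
Proof. by rewrite invr_gt0 !mulr_gt0// expR_gt0. Qed.

Lemma invariant_densityE x : p x = (sigma x)^-1 * (L^-1 * expR (D x)).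
Proof.
by rewrite /invariant_density /psi2 expRN !invfM invrK; ring.
Qed.

Lemma continuous_invariant_density : continuous p.
Proof.
rewrite (funext invariant_densityE) => x; apply: cvgM; first exact: csV.
apply: cvgM; first exact: cvg_cst.
by apply: continuous_comp; [exact: cD|exact: continuous_expR].
Qed.

Lemma integrable_invariant_density : mu.-integrable setT (EFin \o p).
Proof.
apply/integrableP; split.
  apply/measurable_EFinP.
  exact: measurable_continuous continuous_invariant_density.
under eq_integral do rewrite /= ger0_norm ?ltW ?invariant_density_gt0//.
by have := Pi_setT ss sm s0 tm_fin; rewrite /Pi => ->; rewrite ltry.
Qed.

Lemma integral_invariant_density : \int[mu]_x p x = 1.
Proof.
by have := Pi_setT ss sm s0 tm_fin; rewrite /Pi /Rintegral => ->.
Qed.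

Lemma integral_Pi (f : R -> R) : continuous f ->
  (\int[Pi sigma m]_x (f x)%:E = \int[mu]_x (f x * p x)%:E)%E.
Proof.
move=> cf; rewrite -[Pi sigma m]/(density mu p) integral_density//.
- by move=> x; exact/ltW/invariant_density_gt0.
- exact: integrable_invariant_density.
- by apply/measurable_EFinP; exact: measurable_continuous.
Qed.

Lemma integrable_Pi (f : R -> R) : continuous f ->
  (Pi sigma m).-integrable setT (EFin \o f) <->
  mu.-integrable setT (fun x => (f x * p x)%:E).
Proof.
move=> cf; rewrite -[Pi sigma m]/(density mu p); apply: integrable_density.
- by move=> x; exact/ltW/invariant_density_gt0.
- exact: integrable_invariant_density.
- by apply/measurable_EFinP; exact: measurable_continuous.
Qed.

Lemma ge0_integrable_Pi (f : R -> R) : continuous f -> (forall x, 0 <= f x) ->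
  (\int[Pi sigma m]_x (f x)%:E < +oo)%E ->
  mu.-integrable setT (fun x => (f x * p x)%:E).
Proof.
move=> cf f0 foo; apply/integrable_Pi => //; apply/integrableP; split.
  by apply/measurable_EFinP; exact: measurable_continuous.
rewrite (_ : (fun x => `|(EFin \o f) x|%E) = EFin \o f)//.
by apply/funext => x; rewrite /= ger0_norm.
Qed.

(** In the coordinate [V] the diffusion has drift [m / sigma] and invariant
    density [sigma p], and the logarithmic derivative of the latter is twice the
    former. This is what brings [m / sigma], hence [gamma], into play. *)
Lemma is_derive_sigma_invariant_density (x : R) :
  is_derive x 1 (fun y => sigma y * p y : R) (2 * (m x / sigma x * p x)).
Proof.
rewrite (_ : (fun _ => _) = (fun y => L^-1 * expR (D y))); last first.
  by apply/funext => y; rewrite invariant_densityE mulVKf// gt_eqF.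
have dD := is_derive_drift_int ss sm s0 x.
have dE : is_derive x 1 (expR \o D : R -> R)
    (2 * m x / sigma x ^+ 2 * expR (D x)).
  have := @is_derive1_comp R expR D x _ _ (is_derive_expR _) dD.
  by rewrite mulrC.
rewrite (_ : 2 * _ = L^-1 *: (2 * m x / sigma x ^+ 2 * expR (D x))).
  exact: is_deriveZ.
by rewrite invariant_densityE /GRing.scale/=; field; rewrite !gt_eqF.
Qed.

(** * The energy of the normalized test function *)

Hypothesis V_L2 : (\int[Pi sigma m]_x (V sigma x ^+ 2)%:E < +oo)%E.

Let cV : continuous (V sigma) := continuous_V.
Let cp : continuous p := continuous_invariant_density.
Let ip := integrable_invariant_density.
Let p0 x : 0 <= p x. Proof. exact/ltW/invariant_density_gt0. Qed.

Let continuous_sqr (h : R -> R) :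
  continuous h -> continuous (fun x => h x ^+ 2).
Proof. by move=> ch x; apply: cvgM; exact: ch. Qed.

Let cVc c : continuous (fun x => V sigma x - c).
Proof. by move=> x; apply: cvgB; [exact: cV|exact: cvg_cst]. Qed.

(** [V] is square integrable, and [Pi] is finite: pair [V] with the constant
    [1]. *)
Lemma integrable_V : mu.-integrable setT (EFin \o (fun x => V sigma x * p x)).
Proof.
have i1 : mu.-integrable setT (fun x => (1 ^+ 2 * p x)%:E).
  by apply: eq_integrable ip => // x _; rewrite /= expr1n mul1r.
have iV : mu.-integrable setT (fun x => (V sigma x ^+ 2 * p x)%:E).
  apply: ge0_integrable_Pi => //; first exact: continuous_sqr.
  by move=> x; exact: sqr_ge0.
have : mu.-integrable setT (fun x => (V sigma x * 1 * p x)%:E).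
  apply: (integrable_weighted_prod (b := cst 1)) => //;
    exact: measurable_continuous.
by apply: eq_integrable => // x _; rewrite mulr1.
Qed.

Lemma integrable_centered_V c :
  mu.-integrable setT (fun x => ((V sigma x - c) ^+ 2 * p x)%:E).
Proof.
have iV : mu.-integrable setT (fun x => (V sigma x ^+ 2 * p x)%:E).
  apply: ge0_integrable_Pi => //; first exact: continuous_sqr.
  by move=> x; exact: sqr_ge0.
have := integrableD measurableT iV (integrableD measurableT
  (integrableZl measurableT (- 2 * c) integrable_V)
  (integrableZl measurableT (c ^+ 2) ip)).
apply: eq_integrable => // x _; rewrite /= -!EFinM -!EFinD.
by congr EFin; ring.
Qed.

Lemma integral_centered_V :
  \int[mu]_x ((V sigma x - \int[mu]_x (V sigma x * p x)) * p x) = 0.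
Proof.
set c := \int[mu]_x (V sigma x * p x).
have iV := integrable_V.
have ic : mu.-integrable setT (EFin \o (fun x => c * p x)).
  exact: (integrableZl measurableT c ip).
under eq_Rintegral do rewrite mulrBl.
rewrite RintegralB// RintegralZl// integral_invariant_density//.
by rewrite mulr1 subrr.
Qed.

(** The test function is [f = (V - c) / sqrt B]. As [V' = 1 / sigma], the factor
    [sigma^2] of [1 / s'] cancels and [(f')^2 / s' = p / B]. *)
Lemma spectral_gap_le_variance (c := \int[mu]_x (V sigma x * p x))
    (B := \int[mu]_x ((V sigma x - c) ^+ 2 * p x)) :
  0 < B -> (spectral_gap sigma m <= (2^-1 * B^-1)%:E)%E.
Proof.
move=> B0; have sB0 : 0 < Num.sqrt B by rewrite sqrtr_gt0.
pose f x := (Num.sqrt B)^-1 * (V sigma x - c).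
have f2E x : f x ^+ 2 = B^-1 * (V sigma x - c) ^+ 2.
  by rewrite exprMn exprVn sqr_sqrtr// ltW.
have cf : continuous f by move=> x; apply: cvgM; [exact: cvg_cst|exact: cVc].
have df (x : R) : is_derive x 1 (f : R -> R) ((Num.sqrt B)^-1 * (sigma x)^-1).
  apply: is_deriveZ; rewrite -(subr0 (sigma x)^-1); apply: is_deriveB.
  exact: is_derive_V.
have f'E : derive1 f = fun x => (Num.sqrt B)^-1 * (sigma x)^-1.
  by apply/funext => x; rewrite derive1E; have [_ ->] := df x.
have ib := integrable_centered_V c.
have intf2 : (\int[mu]_x (f x ^+ 2 * p x)%:E = 1)%E.
  under eq_integral do rewrite f2E -mulrA EFinM.
  rewrite integralZl//.
  rewrite -(fineK (integrable_fin_num measurableT ib)) -/(Rintegral _ _ _) -/B.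
  by rewrite -EFinM mulVf// gt_eqF.
apply: ereal_inf_lbound; exists f; last first.
  rewrite /energy f'E.
  have -> : (\int[mu]_x (((Num.sqrt B)^-1 * (sigma x)^-1) ^+ 2 /
      scale_deriv sigma m x)%:E = \int[mu]_x ((B^-1)%:E * (p x)%:E))%E.
    apply: eq_integral => x _; rewrite -EFinM /scale_deriv /invariant_density.
    rewrite exprMn exprVn sqr_sqrtr ?ltW//; congr EFin.
    have := invariant_density_gt0 x; rewrite invr_gt0 => psi0.
    by field; rewrite !gt_eqF.
  rewrite integralZl// -(fineK (integrable_fin_num measurableT ip)).
  by rewrite -/(Rintegral _ _ _) integral_invariant_density// EFinM mule1.
split.
- apply: smooth_derive1; first by move=> x; have [] := df x.
  rewrite f'E; apply/smooth_nderivable => n; apply: nderivableM.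
    exact: nderivable_cst.
  apply: nderivableV; first by move=> x; rewrite gt_eqF.
  exact: (smooth_nderivable _).1.
- apply/(integrable_Pi (continuous_sqr cf)).
  under eq_fun do rewrite f2E -mulrA.
  exact: (integrableZl measurableT B^-1 ib).
- rewrite integral_Pi//; under eq_integral do rewrite /f -mulrA EFinM.
  have ic : mu.-integrable setT (fun x => ((V sigma x - c) * p x)%:E).
    have := integrableB measurableT integrable_V
      (integrableZl measurableT c ip).
    by apply: eq_integrable => // x _; rewrite /= mulrBl.
  rewrite integralZl// -(fineK (integrable_fin_num measurableT ic)).
  by rewrite -/(Rintegral _ _ _) integral_centered_V mule0.
- rewrite integral_Pi//; exact: continuous_sqr.
Qed.

(** * The integration by parts *)

Hypothesis recurrent_left : (\int[mu]_(x in `]-oo, 0%R])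
  ((sigma x)^-1 * expR (- D x))%:E = +oo)%E.
Hypothesis recurrent_right : (\int[mu]_(x in `[0%R, +oo[)
  ((sigma x)^-1 * expR (- D x))%:E = +oo)%E.

(** The constant [c] is arbitrary, as it enters only through the boundary terms
    of the integration by parts, which vanish. *)
Lemma integral_drift_V (c : R) :
  mu.-integrable setT (fun x => ((m x / sigma x) ^+ 2 * p x)%:E) ->
  mu.-integrable setT (fun x => ((V sigma x - c) ^+ 2 * p x)%:E) ->
  \int[mu]_x (m x / sigma x * (V sigma x - c) * p x) = - 2^-1.
Proof.
move=> ia ib.
pose a x := m x / sigma x; pose b x := V sigma x - c.
have ca : continuous a by move=> x; apply: cvgM; [exact: cm|exact: csV].
have cb : continuous b.
  by move=> x; apply: cvgB; [exact: continuous_V|exact: cvg_cst].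
have iab : mu.-integrable setT (EFin \o (fun x => a x * b x * p x)).
  by apply: integrable_weighted_prod => //; exact: measurable_continuous.
pose q x := (sigma x)^-1 * expR (- D x).
pose G x := sigma x * p x * b x.
pose g x := 2 * (a x * b x * p x) + p x.
have dG (x : R) : is_derive x 1 (G : R -> R) (g x).
  have db : is_derive x 1 (b : R -> R) ((sigma x)^-1).
    rewrite -(subr0 (sigma x)^-1); apply: is_deriveB.
    exact: is_derive_V.
  have := @is_deriveM _ _ (fun y => sigma y * p y : R) b x 1 _ _
    (is_derive_sigma_invariant_density x) db.
  congr is_derive; rewrite /g /a /GRing.scale/=.
  by field; rewrite !gt_eqF.
have cg : continuous g.
  move=> x; apply: cvgD; last exact: cp.
  apply: cvgM; first exact: cvg_cst.
  apply: cvgM; last exact: cp.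
  by apply: cvgM; [exact: ca|exact: cb].
have i2 : mu.-integrable setT (EFin \o (fun x => 2 * (a x * b x * p x))).
  exact: (integrableZl measurableT 2 iab).
have ig : mu.-integrable setT (EFin \o g).
  exact: (integrableD measurableT i2 ip).
have cq : continuous q.
  move=> x; apply: cvgM; first exact: csV.
  by apply: continuous_comp; [exact/continuousN/cD|exact: continuous_expR].
have q0 x : 0 <= q x by rewrite mulr_ge0 ?invr_ge0 ?expR_ge0// ltW.
have ik : mu.-integrable setT (EFin \o (fun x => L^-1 * (b x ^+ 2 * p x))).
  exact: (integrableZl measurableT (L^-1) ib).
(* An equality in fact: q = (L * sigma^2 * p)^-1. *)
have qk x : q x * G x ^+ 2 <= L^-1 * (b x ^+ 2 * p x).
  rewrite /q /G invariant_densityE expRN le_eqVlt; apply/orP; left; apply/eqP.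
  by field; rewrite !gt_eqF// expR_gt0.
have g0 : \int[mu]_x g x = 0.
  rewrite /Rintegral (@integral_derivative_eq0 _ G g)// => e N e0.
    have [x [/= x0 Nx Gx]] := small_far_out N
      (measurable_itv `[0%R, +oo[) cq q0 ik qk recurrent_right e0.
    exists x; move: x0 Nx; rewrite in_itv/= andbT => x0.
    by rewrite ger0_norm.
  have [x [/= x0 Nx Gx]] := small_far_out N
    (measurable_itv `]-oo, 0%R]) cq q0 ik qk recurrent_left e0.
  exists x; move: x0 Nx; rewrite in_itv/= => x0.
  by rewrite ler0_norm.
have := g0; rewrite /g RintegralD// integral_invariant_density RintegralZl//.
rewrite -/(a _) -/(b _).
by set H := Rintegral _ _ _ => H0; lra.
Qed.
End Diffusion.

(** * Comparison with gamma *)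

Unset Implicit Arguments.

Theorem theorem3p3 (R : realType) (sigma m : R -> R)
  (sigma_smooth : smooth sigma) (m_smooth : smooth m)
  (sigma_gt0 : forall x : R, 0 < sigma x)
  (recurrent_left : (\int[lebesgue_measure]_(x in `]-oo, 0%R])
     ((sigma x)^-1 * expR (- drift_int sigma m x))%:E = +oo)%E)
  (recurrent_right : (\int[lebesgue_measure]_(x in `[0%R, +oo[)
     ((sigma x)^-1 * expR (- drift_int sigma m x))%:E = +oo)%E)
  (positive_recurrent : (total_mass sigma m < +oo)%E)
  (V_L2 : (\int[Pi sigma m]_x (V sigma x ^+ 2)%:E < +oo)%E)
  (sigma_L2 : (\int[Pi sigma m]_x (sigma x ^+ 2)%:E < +oo)%E)
  (gamma_fin : (gamma sigma m < +oo)%E) :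
  (spectral_gap sigma m <= gamma sigma m)%E.
Proof.
have cs := smooth_continuous sigma_smooth.
have cm := smooth_continuous m_smooth.
pose p := invariant_density sigma m.
pose c := \int[lebesgue_measure]_x (V sigma x * p x).
have ca : continuous (fun x => m x / sigma x).
  by move=> x; apply: cvgM; [exact: cm|apply: cvgV; [rewrite gt_eqF|exact: cs]].
have ca2 : continuous (fun x => (m x / sigma x) ^+ 2).
  by move=> x; apply: cvgM; exact: ca.
have cp : continuous p by exact: continuous_invariant_density.
have p0 x : 0 <= p x by exact/ltW/invariant_density_gt0.
have gammaE : gamma sigma m =
    (2%:E * \int[Pi sigma m]_x ((m x / sigma x) ^+ 2)%:E)%E.
  rewrite /gamma; do 3!congr (_ _).
  by apply/funext => x; rewrite exprMn exprVn.
have ia : lebesgue_measure.-integrable setT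
    (fun x => ((m x / sigma x) ^+ 2 * p x)%:E).
  apply: ge0_integrable_Pi => //; first by move=> x; exact: sqr_ge0.
  rewrite ltNge leye_eq; apply/eqP => Ioo.
  by move: gamma_fin; rewrite gammaE Ioo gt0_muley ?lte_fin ?ltxx.
have ib := integrable_centered_V sigma_smooth m_smooth sigma_gt0
  positive_recurrent V_L2 c.
pose A := \int[lebesgue_measure]_x ((m x / sigma x) ^+ 2 * p x).
pose B := \int[lebesgue_measure]_x ((V sigma x - c) ^+ 2 * p x).
(* The factor 4 is the inverse of the square of integral_drift_V. *)
have AB : 1 <= 4 * A * B.
  have := @weighted_cauchy_schwarz _ _ _ lebesgue_measure
    (fun x => m x / sigma x) (fun x => V sigma x - c) p
    (measurable_continuous ca) _ (measurable_continuous cp) p0 ia ib.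
  rewrite integral_drift_V// -/A -/B.
  have mV : measurable_fun setT (fun x : measurableTypeR R => V sigma x - c).
    apply: measurable_continuous => x; apply: cvgB; last exact: cvg_cst.
    exact: continuous_V.
  by move=> /(_ mV); nra.
have B0 : 0 < B.
  rewrite lt_neqAle; apply/andP; split.
    by apply: contraTneq AB => <-; rewrite mulr0 -ltNge ltr01.
  by apply: Rintegral_ge0 => x _; rewrite mulr_ge0 ?sqr_ge0.
apply: le_trans (spectral_gap_le_variance sigma_smooth m_smooth sigma_gt0
  positive_recurrent V_L2 B0) _.
rewrite gammaE integral_Pi//.
rewrite -(fineK (integrable_fin_num measurableT ia)) -/(Rintegral _ _ _) -/A.
rewrite -EFinM lee_fin -/B ler_pdivrMr//; lra.
Qed.
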